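(* Let $n\ge 3$ and let $C_n$ be the cycle on $n$ vertices. Then $$cn_{\chi}(C_n)=\begin{cases}\frac{n}{2}, & n \text{ even},\\ \frac{n-1}{2}, & n\text{ odd},\end{cases} \qquad\text{and}\qquad cn^c_{\chi}(C_n)=\begin{cases}\frac{n^2}{4}, & n \text{ even},\\ \frac{(n-1)^2}{4}, & n\text{ odd}.\end{cases}$$
   Context: All graphs are finite, simple, undirected and connected. A chromatic colouring of a graph $G$ is a proper vertex colouring with exactly $\chi(G)$ colours $c_1,\ldots,c_\ell$, $\ell=\chi(G)$; the colour class of $c_i$ is denoted $\mathcal{C}_i$ and $\theta(c_i)=|\mathcal{C}_i|$. A $\chi^-$-colouring of $G$ is a chromatic colouring in which the maximum possible number of vertices gets colour $c_1$, then (subject to that) the maximum possible number of the remaining vertices gets $c_2$, then the maximum possible number of the remaining vertices gets $c_3$, and so on; that is, $(\theta(c_1),\ldots,\theta(c_\ell))$ is lexicographically maximal among all chromatic colourings of $G$. With respect to a $\chi^-$-colouring, the chromatic curling number is $cn_{\chi}(G)=\max\{\theta(c_i):1\le i\le \ell\}$ and the chromatic compound curling number is $cn^c_{\chi}(G)=\prod_{i=1}^{\ell}\theta(c_i)$. *)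

(* Defs.v *)
From HB Require Import structures.
From mathcomp Require Import all_boot all_order.

Set Implicit Arguments.
Unset Strict Implicit.
Unset Printing Implicit Defensive.

(* Finite simple connected graphs. *)
Record graph := Graph {
  vertex :> finType;
  adj : rel vertex;
  adj_sym : symmetric adj;
  adj_irr : irreflexive adj;
  adj_conn : forall x y, connect adj x y }.

Section Colouring.
Variable G : graph.

Definition proper k (c : {ffun G -> 'I_k}) : bool :=
  [forall x, forall y, adj x y ==> (c x != c y)].

Definition colourable k : bool := [exists c : {ffun G -> 'I_k}, proper c].

Lemma colourable_card : exists k, colourable k.
Proof.
exists #|G|; apply/existsP; exists [ffun x => enum_rank x].
apply/forallP => x; apply/forallP => y; apply/implyP => xy.
by rewrite !ffunE (inj_eq enum_rank_inj); apply: contraTneq xy => ->; rewrite adj_irr.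
Qed.

Definition chromatic_number : nat := ex_minn colourable_card.

(* Surjectivity expresses "exactly chi(G) colours". *)
Definition chromatic_colouring (c : {ffun G -> 'I_chromatic_number}) : bool :=
  proper c && [forall i, i \in codom c].

Definition theta k (c : {ffun G -> 'I_k}) (i : 'I_k) : nat :=
  #|[set x | c x == i]|.

(* Ordered lexicographically through the type k.-tuplelexi nat. *)
Definition theta_vector k (c : {ffun G -> 'I_k}) : k.-tuplelexi nat :=
  [tuple theta c i | i < k].

Definition chi_minus_colouring (c : {ffun G -> 'I_chromatic_number}) : bool :=
  chromatic_colouring c &&
  [forall c', chromatic_colouring c' ==>
              (theta_vector c' <= theta_vector c)%O].

Lemma chromatic_colouring_exists : exists c, chromatic_colouring c.
Proof.
rewrite /chromatic_colouring /chromatic_number.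
case: ex_minnP => k /existsP[c pc] kmin; exists c; rewrite pc /=.
apply/forallP => i; apply: contraT => ni.
case: k => [|k] in c pc kmin i ni *; first by case: i ni.
suff /kmin : colourable k by rewrite ltnn.
have nic x : i != c x by apply: contraNneq ni => ->; apply: codom_f.
have [j0 | k0] := pickP 'I_k; last first.
  apply/existsP; suff E (x : G) : False.
    by exists [ffun x => False_rect _ (E x)]; apply/forallP => x; case: (E x).
  by have [j] := unlift_some (nic x); have := k0 j.
move=> _; apply/existsP; exists [ffun x => odflt j0 (unlift i (c x))].
apply/forallP => x; apply/forallP => y; apply/implyP => xy; rewrite !ffunE.
have := forallP (forallP pc x) y; rewrite xy /=.
have [jx -> ->] := unlift_some (nic x); have [jy -> ->] := unlift_some (nic y).
by apply: contraNneq => /= ->.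
Qed.

Lemma chi_minus_colouring_exists : exists c, chi_minus_colouring c.
Proof.
have [c0 hc0] := chromatic_colouring_exists.
case: (@Order.TotalTheory.arg_maxP _ _ _ c0 chromatic_colouring
         (@theta_vector _) hc0) => c hc cmax.
exists c; rewrite /chi_minus_colouring hc; apply/forallP => c'.
by apply/implyP => /cmax.
Qed.

Definition chi_minus := xchoose chi_minus_colouring_exists.

Definition cn_chi : nat := \max_i theta chi_minus i.

Definition cnc_chi : nat := \prod_i theta chi_minus i.

(* Neither number depends on the chi^- colouring chosen. *)
Lemma theta_chi_minus c : chi_minus_colouring c -> theta c =1 theta chi_minus.
Proof.
move=> /andP[hc cmax].
have /andP[hd dmax] := xchooseP chi_minus_colouring_exists.
have E : theta_vector c = theta_vector chi_minus.
  apply: Order.POrderTheory.le_anti.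
  by rewrite (implyP (forallP dmax c) hc) (implyP (forallP cmax _) hd).
by move=> i; have := congr1 (fun t => tnth t i) E; rewrite !tnth_mktuple.
Qed.

Lemma cn_chiE c : chi_minus_colouring c -> cn_chi = \max_i theta c i.
Proof. by move=> hc; apply: eq_bigr => i _; rewrite theta_chi_minus. Qed.

Lemma cnc_chiE c : chi_minus_colouring c -> cnc_chi = \prod_i theta c i.
Proof. by move=> hc; apply: eq_bigr => i _; rewrite theta_chi_minus. Qed.

End Colouring.

Section Cycle.
Variable n : nat.

(* ordS i is i + 1 mod n; the condition i != j only matters for n = 1. *)
Definition cycle_adj : rel 'I_n :=
  fun i j => (i != j) && ((j == ordS i) || (i == ordS j)).

Lemma cycle_adj_sym : symmetric cycle_adj.
Proof. by move=> i j; rewrite /cycle_adj eq_sym orbC. Qed.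

Lemma cycle_adj_irr : irreflexive cycle_adj.
Proof. by move=> i; rewrite /cycle_adj eqxx. Qed.

Lemma cycle_adj_conn i j : connect cycle_adj i j.
Proof.
have stepS k : connect cycle_adj k (ordS k).
  have [<-|kS] := eqVneq k (ordS k); first exact: connect0.
  by apply: connect1; rewrite /cycle_adj kS eqxx.
have n0 : 0 < n by apply: leq_ltn_trans (ltn_ord i).
have from0 m (hm : m < n) : connect cycle_adj (Ordinal n0) (Ordinal hm).
  elim: m hm => [|m IHm] hm.
    by rewrite (_ : Ordinal hm = Ordinal n0) ?connect0 //; apply: val_inj.
  apply: connect_trans (IHm (ltnW hm)) _.
  rewrite (_ : Ordinal hm = ordS (Ordinal (ltnW hm))) ?stepS //.
  by apply: val_inj; rewrite /= modn_small.
have {}from0 k : connect cycle_adj (Ordinal n0) k by case: k.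
apply: connect_trans (from0 j).
by rewrite (sym_connect_sym cycle_adj_sym).
Qed.

Definition cycle_graph : graph :=
  Graph cycle_adj_sym cycle_adj_irr cycle_adj_conn.

End Cycle.

(* Main.v *)
Require Import Defs.
From mathcomp Require Import all_boot.
From mathcomp Require Import all_order zify.

(* The class of a colour and its shift by one are disjoint, so each colour class
   of C_n has at most n/2 vertices; hence n <= k * (n/2) whenever C_n is
   k-colourable, which gives chi(C_n) = 2 or 3. If n is even, the two classes are
   forced to have n/2 vertices each. If n is odd, colouring one vertex with the
   last colour and the remaining path alternately gives class sizes
   ((n-1)/2, (n-1)/2, 1), which are lexicographically maximal by the bound. *)

Lemma sum_theta (G : graph) k (c : {ffun G -> 'I_k}) : \sum_i theta c i = #|G|.
Proof.
rewrite -sum1_card (partition_big c xpredT) //=.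
by apply: eq_bigr => i _; rewrite sum1dep_card.
Qed.

Lemma theta_codom (G : graph) k (c : {ffun G -> 'I_k}) i :
  (i \in codom c) = (0 < theta c i).
Proof.
apply/codomP/card_gt0P => [[x ->]|[x]]; first by exists x; rewrite inE.
by rewrite inE => /eqP <-; exists x.
Qed.

(** Once the chromatic number is known, colourings get the concrete colour type ['I_k], and
    surjectivity becomes positivity of the class sizes. *)
Lemma chi_minusP (G : graph) k : chromatic_number G = k ->
  exists c : {ffun G -> 'I_k},
    [/\ Defs.proper c, cn_chi G = \max_i theta c i, cnc_chi G = \prod_i theta c i &
      forall c' : {ffun G -> 'I_k}, Defs.proper c' -> (forall i, 0 < theta c' i) ->
        (theta_vector c' <= theta_vector c)%O].
Proof.
move=> <-; exists (chi_minus G).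
have /andP[/andP[pc _] /forallP cmax] := xchooseP (chi_minus_colouring_exists G).
split=> // c' pc' c'_gt0; apply: (implyP (cmax c')).
by rewrite /chromatic_colouring pc'; apply/forallP => i; rewrite theta_codom.
Qed.

Lemma chromatic_number_eq (G : graph) k : colourable G k ->
  (forall l, colourable G l -> k <= l) -> chromatic_number G = k.
Proof.
move=> Gk kmin; rewrite /chromatic_number; case: ex_minnP => l Gl lmin.
by apply/eqP; rewrite eqn_leq lmin // kmin.
Qed.

Lemma cycle_theta_le n k (c : {ffun cycle_graph n -> 'I_k}) i :
  1 < n -> Defs.proper c -> theta c i <= n./2.
Proof.
move=> n1 pc; rewrite /theta.
set A : {set 'I_n} := [set x | c x == i].
have dA : [disjoint A & [set ordS x | x in A]].
  rewrite disjoint_sym disjoint_subset; apply/subsetP => _ /imsetP[x xA ->].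
  rewrite !inE in xA *; rewrite -(eqP xA) eq_sym.
  have := forallP (forallP pc x) (ordS x); rewrite /= /cycle_adj eqxx /= andbT.
  (* Adjacency requires [x] and [ordS x] to differ; a fixed point of the shift would force [n = 1],
     also at the wrap-around. *)
  move/implyP; apply; apply/eqP => /(congr1 val) /= E.
  have xn := ltn_ord x; have [/modn_small|] := ltnP x.+1 n; first by lia.
  move=> nx; have xE : x.+1 = n by lia.
  by move: E; rewrite xE modnn; lia.
have := max_card (mem (A :|: [set ordS x | x in A])).
rewrite cardsU disjoint_setI0 // cards0 card_imset ?card_ord; last exact: ordS_inj.
by rewrite subn0 addnn => /half_leq; rewrite doubleK.
Qed.

Lemma cycle_colourable_lower n k :
  1 < n -> colourable (cycle_graph n) k -> n <= k * n./2.
Proof.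
move=> n1 /existsP[c pc]; rewrite -[X in X <= _]card_ord.
rewrite -(sum_theta _ _ c) -[k in k * _]card_ord -sum_nat_const.
by apply: leq_sum => i _; apply: cycle_theta_le.
Qed.

(** The type has 2 or 3 colours according to parity, so both cases share one formula. Colour 2
    occurs only for odd [n], which keeps the argument of [inord] in range. *)
Definition alternating_colouring n : {ffun cycle_graph n -> 'I_(odd n).+2} :=
  [ffun x : 'I_n => inord (if odd n && (x.+1 == n) then 2 else odd x)].

Lemma val_alternating_colouring n (x : 'I_n) :
  alternating_colouring n x = (if odd n && (x.+1 == n) then 2 else odd x) :> nat.
Proof. by rewrite ffunE inordK //; case: (odd n); case: eqP; case: (odd x). Qed.

Lemma alternating_colouring_proper n : 1 < n -> Defs.proper (alternating_colouring n).
Proof.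
move=> n1; have S (x : 'I_n) :
    alternating_colouring n x != alternating_colouring n (ordS x).
  rewrite -val_eqE /= !val_alternating_colouring /=.
  have xn := ltn_ord x; have [xn'|nx] := ltnP x.+1 n.
    rewrite modn_small // (ltn_eqF xn') andbF /=.
    by case: ifP => _; case: (odd x).
  (* The closing edge from [n - 1] to 0: vertex 0 has colour 0, while [n - 1] has colour 2 if [n] is
     odd and colour 1 otherwise. *)
  have xE : x.+1 = n by apply/eqP; rewrite eqn_leq xn.
  have <- : ~~ odd x = odd n by rewrite -[RHS](congr1 odd xE).
  by rewrite xE eqxx modnn (ltn_eqF n1) andbF andbT; case: (odd x).
apply/forallP => x; apply/forallP => y; apply/implyP.
by move=> /andP[_ /orP[] /eqP ->] //; rewrite eq_sym.
Qed.

Lemma cycle_chromatic_number n :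
  1 < n -> chromatic_number (cycle_graph n) = (odd n).+2.
Proof.
move=> n1; apply: chromatic_number_eq => [|l /cycle_colourable_lower-/(_ n1)].
  by apply/existsP; exists (alternating_colouring n);
     apply: alternating_colouring_proper.
(* The counting bound excludes 0 and 1 colours, and with 2 colours it forces [n] to be even. *)
by case: l => [|[|[|l]]]; lia.
Qed.

Lemma even_cycle_theta n (c : {ffun cycle_graph n -> 'I_2}) i :
  1 < n -> ~~ odd n -> Defs.proper c -> theta c i = n./2.
Proof.
move=> n1 ev pc; have := sum_theta _ _ c; rewrite card_ord big_ord_recl big_ord1.
have := cycle_theta_le _ _ c ord0 n1 pc.
have := cycle_theta_le _ _ c (lift ord0 ord0) n1 pc.
case: i => [[|[|//]]] hi; [rewrite (_ : Ordinal hi = ord0)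
  | rewrite (_ : Ordinal hi = lift ord0 ord0)]; try exact: val_inj; lia.
Qed.

Lemma sum_theta3 n (c : {ffun cycle_graph n -> 'I_3}) :
  theta c (inord 0) + theta c (inord 1) + theta c (inord 2) = n.
Proof.
rewrite -[RHS]card_ord -(sum_theta _ _ c) !big_ord_recl big_ord0 addn0 addnA.
by congr (theta c _ + theta c _ + theta c _); apply: val_inj; rewrite /= inordK.
Qed.

Lemma odd_cycle_colouring n : 1 < n -> odd n ->
  exists c : {ffun cycle_graph n -> 'I_3},
    [/\ Defs.proper c, theta c (inord 0) = n./2, theta c (inord 1) = n./2 &
      theta c (inord 2) = 1].
Proof.
move=> n1 on; have := alternating_colouring_proper n n1.
have := val_alternating_colouring n.
move: (alternating_colouring n); rewrite on -[(true : nat).+2]/3 => c cE pc; exists c.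
(* Only the last vertex can have colour 2. The other two classes have at most [n./2] vertices, so
   the total [n] makes all three bounds equalities. *)
have : theta c (inord 2) <= 1.
  have lt_n : n.-1 < n by rewrite ltn_predL ltnW.
  apply: leq_trans (_ : #|[set Ordinal lt_n]| <= 1); last by rewrite cards1.
  apply: subset_leq_card; apply/subsetP => x; rewrite !inE -!val_eqE /= inordK //.
  rewrite cE; case: (x.+1 =P n) => [xE _|_] /=; last by case: (odd x).
  by rewrite -(congr1 predn xE).
have := sum_theta3 _ c.
have := cycle_theta_le _ _ c (inord 0) n1 pc.
have := cycle_theta_le _ _ c (inord 1) n1 pc.
by split=> //; lia.
Qed.

Lemma odd_cycle_theta n (c : {ffun cycle_graph n -> 'I_3}) : 1 < n -> odd n ->
  Defs.proper c ->
  (forall c' : {ffun cycle_graph n -> 'I_3}, Defs.proper c' ->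
     (forall i, 0 < theta c' i) -> (theta_vector c' <= theta_vector c)%O) ->
  [/\ theta c (inord 0) = n./2, theta c (inord 1) = n./2 &
      theta c (inord 2) = 1].
Proof.
move=> n1 on pc cmax; have [c' [pc' c'0 c'1 c'2]] := odd_cycle_colouring n n1 on.
have c'_gt0 i : 0 < theta c' i.
  rewrite -(inord_val i); case: i => [[|[|[|//]]]] hi /=; lia.
(* Here [k] is the first index where the two vectors differ, or 3 if they agree. Equality at index 0
   gives [0 < k], which allows the comparison at index 1; the sum then fixes the last class. *)
have /Order.TupleLexiOrder.lexi_tupleP[k Hk] := cmax c' pc' c'_gt0.
have le0 := cycle_theta_le _ _ c (inord 0) n1 pc.
have le1 := cycle_theta_le _ _ c (inord 1) n1 pc.
have S := sum_theta3 _ c.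
have [] := Hk (inord 0); rewrite ?inordK // !tnth_mktuple c'0 => ge0 E0; rewrite leEnat in ge0.
have {}ge0 : theta c (inord 0) = n./2 by apply/eqP; rewrite eqn_leq le0.
have k0 : 0 < k by rewrite lt0n eq_sym -E0 ge0 eqxx.
have [] := Hk (inord 1); rewrite ?inordK // !tnth_mktuple c'1 => ge1 _; rewrite leEnat in ge1.
by split; lia.
Qed.

Theorem theorem1 (n : nat) (hn : 3 <= n) :
  cn_chi (cycle_graph n) = (if odd n then (n - 1) %/ 2 else n %/ 2) /\
  cnc_chi (cycle_graph n) =
    (if odd n then (n - 1) ^ 2 %/ 4 else n ^ 2 %/ 4).
Proof.
have n1 : 1 < n by apply: ltnW.
have [c [pc -> -> cmax]] := chi_minusP _ _ (cycle_chromatic_number n n1).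
(* The colour type of [c] depends on [odd n], so [c] is generalised before the case split. *)
move: c pc cmax; case: ifP => [on | /negbT ev] c pc cmax.
  have [t0 t1 t2] := odd_cycle_theta n c n1 on pc cmax.
  have E i : theta c i = if i < 2 then n./2 else 1.
    by rewrite -(inord_val i); case: i => [[|[|[|//]]]] hi /=; rewrite inordK.
  rewrite (eq_bigr _ (fun i _ => E i)) [X in _ /\ X = _](eq_bigr _ (fun i _ => E i)).
  rewrite !big_ord_recl !big_ord0 /=.
  have -> : n - 1 = n./2 * 2 by lia.
  by rewrite expnMn !mulnK //; split; lia.
have E i : theta c i = n./2 by apply: even_cycle_theta.
rewrite (eq_bigr _ (fun i _ => E i)) [X in _ /\ X = _](eq_bigr _ (fun i _ => E i)).
rewrite !big_ord_recl !big_ord0 /=.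
have nE : n = n./2 * 2 by lia.
(* Only the two dividends are rewritten, so that both divisions become exact. *)
by rewrite {3 6}nE expnMn !mulnK //; split; lia.
Qed.
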